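(* Let $A>0$, $0<\alpha<1$, $\beta\in\mathbb{R}$, $\rho_\pm>0$, $u_\pm\in\mathbb{R}$. Consider the Riemann problem $$\rho_t+(\rho u)_x=0,\qquad \Big(\rho\big(u-\tfrac{A}{\rho^{\alpha}}\big)\Big)_t+\Big(\rho u\big(u-\tfrac{A}{\rho^{\alpha}}\big)\Big)_x=\beta\rho,$$ $(\rho,u)(x,0)=(\rho_-,u_-)$ for $x<0$ and $(\rho_+,u_+)$ for $x>0$. If $u_+<u_--\frac{A}{\rho_-^\alpha}$ and $\rho_+\neq\rho_-$, then the delta shock solution (in the sense defined in the context) of this Riemann problem is $$(\rho,u)(x,t)=\begin{cases}(\rho_-,u_-+\beta t),&x<x(t),\\ (w(t)\delta(x-x(t)),u_\delta(t)),&x=x(t),\\ (\rho_+,u_++\beta t),&x>x(t),\end{cases}$$ with $$\sigma(t)=u_\delta(t)=v_\delta+\beta t,\qquad x(t)=v_\delta t+\tfrac12\beta t^2,\qquad w(t)=w_0t,$$ where $$w_0=\sqrt{\rho_+\rho_-(u_+-u_-)\Big((u_+-u_-)-\big(\tfrac{A}{\rho_+^\alpha}-\tfrac{A}{\rho_-^\alpha}\big)\Big)+\tfrac14\Big(\tfrac{A}{\rho_+^{\alpha-1}}-\tfrac{A}{\rho_-^{\alpha-1}}\Big)^2}-\tfrac12\Big(\tfrac{A}{\rho_+^{\alpha-1}}-\tfrac{A}{\rho_-^{\alpha-1}}\Big),\qquad v_\delta=\frac{\rho_+u_+-\rho_-u_-+w_0}{\rho_+-\rho_-}.$$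
   Context: A delta shock solution of the Riemann problem is a pair of the piecewise form displayed in the claim, with $x(t),w(t),u_\delta(t)$ smooth for $t\ge 0$, $x(0)=0$, $w(0)=0$, and $u_\delta(t)-\beta t$ constant in $t$, such that the following three conditions hold. (1) Generalized Rankine–Hugoniot conditions: $$\frac{dx(t)}{dt}=\sigma(t)=u_\delta(t),\qquad \frac{dw(t)}{dt}=\sigma(t)[\rho]-[\rho u],\qquad \frac{d(w(t)u_\delta(t))}{dt}=\sigma(t)\Big[\rho\big(u-\tfrac{A}{\rho^\alpha}\big)\Big]-\Big[\rho u\big(u-\tfrac{A}{\rho^\alpha}\big)\Big]+\beta w(t),$$ where $[\,\cdot\,]$ denotes the value at the right state $(\rho_+,u_++\beta t)$ minus the value at the left state $(\rho_-,u_-+\beta t)$; e.g. $[\rho u]=\rho_+(u_++\beta t)-\rho_-(u_-+\beta t)$. (2) Over-compressive entropy condition: $u_++\beta t<u_\delta(t)<u_--\frac{A}{\rho_-^\alpha}+\beta t$. (3) The equations hold in the sense of distributions: for all $\psi\in C_0^\infty(\mathbb{R}\times(0,\infty))$, $$\langle\rho,\psi_t\rangle+\langle\rho u,\psi_x\rangle=0,\qquad \Big\langle\rho\big(u-\tfrac{A}{\rho^\alpha}\big),\psi_t\Big\rangle+\Big\langle\rho u\big(u-\tfrac{A}{\rho^\alpha}\big),\psi_x\Big\rangle=-\langle\beta\rho,\psi\rangle .$$ Here the products are defined as follows: with $\hat\rho=\rho_\pm$, $\hat u=u_\pm+\beta t$ for $\pm(x-x(t))>0$, and with the convention that $A/\rho^\alpha$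 equals zero on the delta shock curve, $\langle\rho,\psi\rangle=\iint\hat\rho\psi\,dx\,dt+\int_0^\infty w(t)\psi(x(t),t)\,dt$; $\langle\rho u,\psi\rangle=\iint\hat\rho\hat u\psi\,dx\,dt+\int_0^\infty w(t)u_\delta(t)\psi(x(t),t)\,dt$; $\langle\rho(u-\frac{A}{\rho^\alpha}),\psi\rangle=\iint\hat\rho(\hat u-\frac{A}{\hat\rho^\alpha})\psi\,dx\,dt+\int_0^\infty w(t)u_\delta(t)\psi(x(t),t)\,dt$; $\langle\rho u(u-\frac{A}{\rho^\alpha}),\psi\rangle=\iint\hat\rho\hat u(\hat u-\frac{A}{\hat\rho^\alpha})\psi\,dx\,dt+\int_0^\infty w(t)u_\delta(t)^2\psi(x(t),t)\,dt$, where all double integrals are over $\mathbb{R}\times(0,\infty)$. *)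

(* Defs.v *)
From mathcomp Require Import all_boot all_order all_algebra.
From mathcomp Require Import all_classical all_reals all_analysis.

Set Implicit Arguments.
Unset Strict Implicit.
Unset Printing Implicit Defensive.

Import Order.TTheory GRing.Theory Num.Theory.
Import numFieldNormedType.Exports.

Local Open Scope classical_set_scope.
Local Open Scope ring_scope.

Section Smoothness.
Variable R : realType.

(* [l] is the derivative of [f] at [t] relative to the half-line [0, +oo[:
   two-sided for 0 < t, right derivative for t = 0.  Values of [f] at
   negative arguments play no role. *)
Definition has_derivative_ge0 (f : R -> R) (t l : R) : Prop :=
  h^-1 * (f (t + h) - f t)
    @[h --> within [set h : R | h != 0 /\ 0 <= t + h] (nbhs (0 : R))] --> l.

Definition smooth_ge0 (f : R -> R) : Prop :=
  exists d : nat -> R -> R, d 0%N = f /\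
    forall n t, 0 <= t -> has_derivative_ge0 (d n) t (d n.+1 t).

Definition partial_x (psi : R * R -> R) : R * R -> R :=
  fun z => 'D_(1, 0) psi z.

Definition partial_t (psi : R * R -> R) : R * R -> R :=
  fun z => 'D_(0, 1) psi z.

Fixpoint class_C (k : nat) (psi : R * R -> R) : Prop :=
  continuous psi /\
  if k is k'.+1 then
    (forall z, derivable psi z (1, 0)) /\ (forall z, derivable psi z (0, 1)) /\
    class_C k' (partial_x psi) /\ class_C k' (partial_t psi)
  else True.

(* C_0^oo(R x ]0, +oo[); points are pairs (x, t), and a test function is
   identified with its extension by zero to the whole plane. *)
Definition test_function (psi : R * R -> R) : Prop :=
  (forall k, class_C k psi) /\
  compact (closure [set z | psi z != 0]) /\
  closure [set z | psi z != 0] `<=` [set z | 0 < z.2].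

End Smoothness.

Section DeltaShock.
Variable R : realType.
Variables A alpha beta : R.
(* m = minus (left state), p = plus (right state) *)
Variables rhom rhop um up : R.

(* The densities and fluxes, as functions of the state (r, v). *)
Definition mass (r v : R) : R := r.
Definition mass_flux (r v : R) : R := r * v.
Definition momentum (r v : R) : R := r * (v - A / r `^ alpha).
Definition momentum_flux (r v : R) : R := r * v * (v - A / r `^ alpha).

Definition jump (f : R -> R -> R) (t : R) : R :=
  f rhop (up + beta * t) - f rhom (um + beta * t).

Definition generalized_RH (x w udelta sigma : R -> R) : Prop :=
  forall t, 0 <= t ->
    [/\ sigma t = udelta t,
        has_derivative_ge0 x t (sigma t),
        has_derivative_ge0 w t (sigma t * jump mass t - jump mass_flux t) &
        has_derivative_ge0 (fun s => w s * udelta s) t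
          (sigma t * jump momentum t - jump momentum_flux t + beta * w t)].

Definition overcompressive (udelta : R -> R) : Prop :=
  forall t, 0 <= t ->
    up + beta * t < udelta t /\
    udelta t < um - A / rhom `^ alpha + beta * t.

(* The regular part of the solution at the point (x, t), given the front.
   The value on the front itself (a null set) is immaterial. *)
Definition rho_hat (front : R -> R) (z : R * R) : R :=
  if z.1 < front z.2 then rhom else rhop.

Definition u_hat (front : R -> R) (z : R * R) : R :=
  (if z.1 < front z.2 then um else up) + beta * z.2.

(* Action on [psi] of the distribution with regular part f(rho_hat, u_hat) and
   a Dirac part of weight [c] carried by the front; the integrals are Lebesgue
   integrals. *)
Definition pairing (front : R -> R) (f : R -> R -> R) (c : R -> R)
    (psi : R * R -> R) : R :=
  \int[(lebesgue_measure \x lebesgue_measure)%E]_(z in setT `*` `]0, +oo[)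
     (f (rho_hat front z) (u_hat front z) * psi z) +
  \int[lebesgue_measure]_(t in `]0, +oo[) (c t * psi (front t, t)).

(* A / rho ^ alpha vanishes on the front: the Dirac parts of [momentum] and
   [momentum_flux] are w * udelta and w * udelta ^ 2. *)
Definition weak_solution (x w udelta : R -> R) : Prop :=
  forall psi, test_function psi ->
    pairing x mass w (partial_t psi) +
      pairing x mass_flux (fun t => w t * udelta t) (partial_x psi) = 0 /\
    pairing x momentum (fun t => w t * udelta t) (partial_t psi) +
      pairing x momentum_flux (fun t => w t * udelta t ^+ 2) (partial_x psi)
    = - (beta * pairing x mass w psi).

(* The pair (rho, u) equal to (rhom, um + beta t) for X < x t, to
   (rhop, up + beta t) for x t < X, and to (w t * delta (X - x t), udelta t)
   on the front X = x t, is encoded by the three functions x, w, udelta on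
   [0, +oo[; sigma is the speed of the front.  The Riemann initial data amount
   to x 0 = 0 and w 0 = 0. *)
Definition delta_shock_solution (x w udelta sigma : R -> R) : Prop :=
  [/\ smooth_ge0 x /\ smooth_ge0 w /\ smooth_ge0 udelta,
      x 0 = 0 /\ w 0 = 0,
      exists v : R, forall t, 0 <= t -> udelta t - beta * t = v,
      generalized_RH x w udelta sigma &
      overcompressive udelta /\ weak_solution x w udelta].

Definition w0 : R :=
  Num.sqrt
    (rhop * rhom * (up - um) *
       ((up - um) - (A / rhop `^ alpha - A / rhom `^ alpha)) +
     4^-1 * (A / rhop `^ (alpha - 1) - A / rhom `^ (alpha - 1)) ^+ 2) -
  2^-1 * (A / rhop `^ (alpha - 1) - A / rhom `^ (alpha - 1)).

Definition vdelta : R := (rhop * up - rhom * um + w0) / (rhop - rhom).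

End DeltaShock.

(* Main.v *)
(* Along the front X, the mass Rankine-Hugoniot condition says that the weight w
   grows at the constant rate c = v [rho] - [rho u]_0, where v is the initial
   speed; multiplying the momentum condition by [rho] turns it into
   c^2 + [A rho^(1 - alpha)] c = Q with Q > 0.  The entropy condition forces
   c > 0, which selects the root w0; conversely the entropy condition follows
   from c > 0 by a sign discussion of the momentum condition.
   For the weak form, Fubini's theorem writes each pairing as a time integral
   over a bounded interval of an expression in S(y, t), the integral of the test
   function over ]-oo, y] at time t.  By the chain rule along X and
   differentiation under the integral sign, the Rankine-Hugoniot conditions make
   the total integrand the derivative of a function vanishing at both ends. *)
Require Import Defs.
From mathcomp Require Import all_boot all_order all_algebra.
From mathcomp Require Import all_classical all_reals all_analysis.
From mathcomp Require Import measurable_realfun.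
From mathcomp Require Import ring lra.
Import Order.TTheory GRing.Theory Num.Theory.
Import numFieldNormedType.Exports.
Local Open Scope classical_set_scope.
Local Open Scope ring_scope.

Set Implicit Arguments.
Unset Strict Implicit.
Unset Printing Implicit Defensive.

(** * Measurability, continuity and partial derivatives of functions on the plane *)

Lemma continuous_measurable_fun2 (R : realType) (g : R * R -> R) :
  continuous g ->
  measurable_fun [set: measurableTypeR R * measurableTypeR R] g.
Proof.
move=> /continuousP cg.
apply: (measurability _ (RGenOpens.measurableE R)).
move=> _ [_ [a [b ->] <-]]; rewrite setTI.
have oU : open (g @^-1` `]a, b[) by apply: cg; exact: interval_open.
set U := g @^-1` _ in oU *.
(* An open set of the plane is the union of the boxes with rational corners that it contains. These
   are countably many measurable rectangles, which gives measurability for the product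
   sigma-algebra. *)
pose box (q : (rat * rat) * (rat * rat)) : set (R * R) :=
  `]ratr q.1.1, ratr q.1.2[ `*` `]ratr q.2.1, ratr q.2.2[.
pose F q := if pselect (box q `<=` U) then box q else set0.
have -> : U = \bigcup_q F q.
  apply/seteqP; split => [z Uz|z [q _]]; last first.
    by rewrite /F; case: pselect => [qU /qU|].
  have /nbhs_ballP[e /= e0 ze] : nbhs z U by exact: open_nbhs_nbhs.
  have approx (x : R) : exists p : rat * rat,
      (`]ratr p.1, ratr p.2[%classic : set R) x /\
      (`]ratr p.1, ratr p.2[%classic : set R) `<=` ball x e.
    have [p1 /[!in_itv]/= /andP[p11 p12]] : exists q, ratr q \in `]x - e, x[.
      by apply: rat_in_itvoo; rewrite ltrBlDr ltrDl.
    have [p2 /[!in_itv]/= /andP[p21 p22]] : exists q, ratr q \in `]x, x + e[.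
      by apply: rat_in_itvoo; rewrite ltrDl.
    exists (p1, p2); rewrite in_itv/= p12 p21; split => // y/=.
    rewrite in_itv/= ball_itv/= in_itv/= => /andP[p1y yp2].
    by rewrite (lt_trans p11)// (lt_trans yp2).
  have [p [zp pe]] := approx z.1; have [q [zq qe]] := approx z.2.
  exists (p, q) => //; rewrite /F; case: pselect => [?|]; first by split.
  by case => y [/= y1 y2]; apply: ze; split; [exact: pe|exact: qe].
apply: (@countable_bigcupT_measurable _ (measurableTypeR R * measurableTypeR R)%type _ F).
  exact: countableP.
move=> q; rewrite /F; case: pselect => ?; last exact: measurable0.
by apply: (@measurableX _ _ (measurableTypeR R) (measurableTypeR R));
  exact: measurable_itv.
Qed.

Section curves.
Variable R : realType.
Implicit Types (f g : R * R -> R) (X : R -> R).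

Lemma continuous_pairl g t : continuous g -> continuous (fun s => g (s, t)).
Proof.
move=> cg s; apply: (@continuous_comp _ _ _ (fun s => (s, t)) g); last exact: cg.
exact: cvg_pair cvg_id (cvg_cst _).
Qed.

Lemma continuous_along g X : continuous g -> continuous X ->
  continuous (fun t => g (X t, t)).
Proof.
move=> cg cX t; apply: (@continuous_comp _ _ _ (fun t => (X t, t)) g); last exact: cg.
exact: cvg_pair (cX t) cvg_id.
Qed.

Lemma is_derive_partial_x g (x t : R) : derivable g (x, t) (1, 0) ->
  is_derive x 1 (fun s => g (s, t)) (partial_x g (x, t)).
Proof.
move=> dg; rewrite /partial_x.
have e : (fun h : R => h^-1 *: (g (h *: (1, 0) + (x, t)) - g (x, t))) =
    (fun h => h^-1 *: ((fun s => g (s, t)) (h *: 1 + x) - g (x, t))).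
  apply/funext => h; congr (_ *: (g _ - _)).
  by apply: injective_projections => /=; rewrite ?scaler0 ?add0r.
by split; [move: dg; rewrite /derivable e|rewrite /derive e].
Qed.

Lemma is_derive_partial_t g (x t : R) : derivable g (x, t) (0, 1) ->
  is_derive t 1 (fun s => g (x, s)) (partial_t g (x, t)).
Proof.
move=> dg; rewrite /partial_t.
have e : (fun h : R => h^-1 *: (g (h *: (0, 1) + (x, t)) - g (x, t))) =
    (fun h => h^-1 *: ((fun s => g (x, s)) (h *: 1 + t) - g (x, t))).
  apply/funext => h; congr (_ *: (g _ - _)).
  by apply: injective_projections => /=; rewrite ?scaler0 ?add0r.
by split; [move: dg; rewrite /derivable e|rewrite /derive e].
Qed.

End curves.

(** * Chain rule along a curve, and derivatives of slice integrals *)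

Section derivatives_along_curves.
Variable R : realType.
Implicit Types (g : R * R -> R) (X : R -> R).

Lemma is_derive_cvgP (f : R -> R) (t l : R) :
  is_derive t 1 f l <-> h^-1 * (f (t + h) - f t) @[h --> 0^'] --> l.
Proof.
have e : (fun h : R => h^-1 *: (f (h *: 1 + t) - f t)) =
         (fun h => h^-1 * (f (t + h) - f t)).
  by apply/funext => h; rewrite scaler1 [h + t]addrC.
split => [[df <-]|fl].
  by rewrite -e; exact: df.
split; first by apply/cvg_ex; exists l; rewrite /= e.
by rewrite /derive e; exact: cvg_lim.
Qed.

(** The increment is split at the intermediate point [(X t0, t0 + h)]: the mean value theorem
    handles the [x] part, the definition of the derivative the [t] part. The bound [lo] is there for
    slice integrals, whose [x] derivative is the integrand only to the right of the lower limit. *)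
Lemma is_derive_along (f fx : R -> R -> R) X (lo t0 X' ft : R) :
  lo < X t0 ->
  (forall x t, lo < x -> is_derive x 1 (f ^~ t) (fx x t)) ->
  {for (X t0, t0), continuous (fun z => fx z.1 z.2)} ->
  is_derive t0 1 (f (X t0)) ft -> is_derive t0 1 X X' ->
  is_derive t0 1 (fun t => f (X t) t) (fx (X t0) t0 * X' + ft).
Proof.
move=> loX dx cfx /is_derive_cvgP dt dX.
have cX : {for t0, continuous X}.
  by apply: differentiable_continuous; apply/derivable1_diffP; case: dX.
have ct0 : t0 + h @[h --> 0^'] --> t0.
  rewrite -[X in _ --> X]addr0; apply: cvgD; first exact: cvg_cst.
  exact: nbhs_dnbhs.
have cXh : X (t0 + h) @[h --> 0^'] --> X t0.
  by apply: (@cvg_comp _ _ _ (fun h => t0 + h) X _ (nbhs t0)) cX; exact: ct0.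
move/is_derive_cvgP in dX; apply/is_derive_cvgP.
(* [xi h] is the mean value point between [X t0] and [X (t0 + h)]. The default 0 is taken only where
   [X (t0 + h) <= lo], hence for no small [h]. *)
have /choice[xi xiP] : forall h, exists xi : R, lo < X (t0 + h) ->
    `|xi - X t0| <= `|X (t0 + h) - X t0| /\
    f (X (t0 + h)) (t0 + h) - f (X t0) (t0 + h) =
      fx xi (t0 + h) * (X (t0 + h) - X t0).
  move=> h; have [lX|] := ltP lo (X (t0 + h)); last by exists 0.
  have D a b : lo < a -> forall x, x \in `]a, b[%R ->
      is_derive x 1 (f ^~ (t0 + h)) (fx x (t0 + h)).
    by move=> la x /[!in_itv]/= /andP[ax _]; apply: dx; exact: lt_trans ax.
  have C a b : lo < a -> {within `[a, b], continuous (f ^~ (t0 + h))}.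
    move=> la; apply: derivable_within_continuous => x /[!in_itv]/= /andP[ax _].
    by have [] : is_derive x 1 (f ^~ (t0 + h)) (fx x (t0 + h))
      by apply: dx; exact: lt_le_trans ax.
  have [le|/ltW le] := leP (X t0) (X (t0 + h)).
    have [c /[!in_itv]/= /andP[c1 c2] cE] := MVT_segment le (D _ _ loX) (C _ _ loX).
    by exists c => _; split => //; rewrite !ger0_norm ?subr_ge0// lerD2r.
  have [c /[!in_itv]/= /andP[c1 c2] cE] := MVT_segment le (D _ _ lX) (C _ _ lX).
  exists c => _; split; first by rewrite !ler0_norm ?subr_le0// lerN2 lerD2r.
  by rewrite -opprB cE -mulrN opprB.
have nearX : \forall h \near 0^', lo < X (t0 + h) by exact: cvgr_gt cXh _ loX.
have cxi : xi h @[h --> 0^'] --> X t0.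
  apply/cvgrPdist_le => e e0; near=> h.
  have [|le _] := xiP h; first by near: h.
  rewrite distrC (le_trans le)// distrC; near: h.
  by move/cvgrPdist_le: cXh; apply.
have cfxi : fx (xi h) (t0 + h) @[h --> 0^'] --> fx (X t0) t0.
  apply: (@cvg_comp _ _ _ (fun h => (xi h, t0 + h)) (fun z => fx z.1 z.2) _
    (nbhs (X t0, t0))); last exact: cfx.
  exact: cvg_pair cxi ct0.
apply: cvg_trans (cvgD (cvgM cfxi dX) dt); apply: near_eq_cvg.
near=> h.
have [|_ fE] := xiP h; first by near: h.
rewrite /= -[in RHS](subrKA (f (X t0) (t0 + h))) fE mulrDr; congr (_ + _).
by rewrite mulrCA.
Unshelve. all: end_near. Qed.

(** Once [g] vanishes for [x <= - L], this is the integral over ]-oo, x]; the finite lower limit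
    keeps everything on compact segments. *)
Definition slice_integral (L : R) g (x t : R) : R :=
  \int[lebesgue_measure]_(s in `[- L, x]) g (s, t).

Lemma integrable_slice g (a b t : R) : continuous g ->
  (@lebesgue_measure R).-integrable `[a, b] (EFin \o (fun s => g (s, t))).
Proof.
move=> cg; apply: continuous_compact_integrable; first exact: segment_compact.
by apply: continuous_subspaceT; exact: continuous_pairl.
Qed.

Lemma is_derive_slice_integral_x g (L x t : R) : continuous g -> - L < x ->
  is_derive x 1 (fun y => slice_integral L g y t) (g (x, t)).
Proof.
(* The upper end [x + 1] makes [x] an interior point, so the derivative is two-sided. *)
move=> cg Lx.
have [||||d e] := @continuous_FTC1_closed R (fun s => g (s, t)) (- L) x (x + 1).
- by rewrite ltrDl.
- exact: integrable_slice.
- by [].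
- by apply: continuous_pairl.
by split => //; rewrite -e derive1E.
Qed.

(** Differentiation under the integral sign, dominated by the constant [C], which is integrable over
    a bounded segment. *)
Lemma is_derive_slice_integral_t g (L C x t : R) : continuous g ->
  (forall z, derivable g z (0, 1)) -> continuous (partial_t g) ->
  (forall z, `|partial_t g z| <= C) ->
  is_derive t 1 (slice_integral L g x) (slice_integral L (partial_t g) x t).
Proof.
move=> cg dg cdg gC.
have pE s y : partial1of2 (fun t' s => g (s, t')) s y = partial_t g (y, s).
  by rewrite partial1of2E; have [_ ->] := is_derive_partial_t (dg (y, s)).
apply/is_derive_cvgP.
have := @cvg_differentiation_under_integral R _ _ lebesgue_measure
  (fun t' s => g (s, t')) `[- L, x] (measurable_itv _) t (t - 1) (t + 1).
move=> /(_ _ _ _ (fun=> C)) H.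
have : h^-1 * (slice_integral L g x (h + t) - slice_integral L g x t)
    @[h --> 0^'] --> slice_integral L (partial_t g) x t.
  have -> : slice_integral L (partial_t g) x t = \int[lebesgue_measure]_(s in `[- L, x])
      partial1of2 (fun t' s => g (s, t')) t s.
    by apply: eq_Rintegral => s _; rewrite pE.
  apply: H.
  - by rewrite /= in_itv/= ltrBlDr !ltrDl ltr01.
  - by move=> s _; exact: integrable_slice.
  - by move=> s y _ _; have [] := is_derive_partial_t (dg (y, s)).
  - by move=> _; exact: le_trans (gC (0, 0)).
  - apply: continuous_compact_integrable; first exact: segment_compact.
    by apply: continuous_subspaceT => ?; exact: cvg_cst.
  - by move=> s y _ _; rewrite pE.
by under [X in _ -> X @ _ --> _]eq_fun do rewrite [t + _]addrC.
Qed.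

End derivatives_along_curves.

(** * Bounds for functions that vanish off a compact set *)

Section compact_support.
Variable R : realType.
Implicit Types (K : set (R * R)) (g : R * R -> R).

Lemma compact_norm_bounded (T : topologicalType) (K : set T) (f : T -> R) :
  compact K -> {within K, continuous f} ->
  exists2 C : R, 0 < C & forall z, K z -> `|f z| < C.
Proof.
move=> cK cf.
have [C [_ CP]] := compact_bounded (continuous_compact cf cK).
have CC : C < `|C| + 1 by rewrite (le_lt_trans (ler_norm _))// ltrDl.
exists (`|C| + 1 + 1); first by rewrite !ltr_wpDl// addr_ge0.
move=> z Kz; apply: le_lt_trans (CP _ CC _ _) _; first by exists z.
by rewrite ltrDl.
Qed.

(** One fixed set [K], rather than the support of each function, serves a test function and its
    partial derivatives at once. *)
Definition vanishes_off K g := forall z, ~ K z -> g z = 0.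

(** Off the closed set [K] the function is zero on a whole neighbourhood, so its derivative is that
    of a constant. *)
Lemma vanishes_off_derive K g v : closed K -> vanishes_off K g ->
  vanishes_off K (fun z => 'D_v g z).
Proof.
move=> cK gK z Kz.
rewrite (@near_eq_derive _ _ _ g (cst 0) z v) ?derive_cst//.
near=> y; apply: gK; near: y.
by apply: open_nbhs_nbhs; split => //; exact: closed_openC.
Unshelve. all: end_near. Qed.

Lemma vanishes_off_bounded K g : compact K -> continuous g -> vanishes_off K g ->
  exists2 C : R, 0 < C & forall z, `|g z| <= C.
Proof.
move=> cK cg gK.
have [|C C0 CP] := @compact_norm_bounded _ K g cK.
  exact: continuous_subspaceT.
exists C => // z; have [/CP/ltW//|/gK->] := pselect (K z).
by rewrite normr0 ltW.
Qed.

End compact_support.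

(** * Fubini's theorem for integrands with a jump across the front *)

Section two_states.
Variable R : realType.
Local Notation mu := (@lebesgue_measure R).
Local Notation mu2 := (mu \x mu)%E.
Implicit Types (g : R * R -> R) (X a b : R -> R).

(** The common form of all densities and fluxes: on each side of the front the state depends on time
    alone. *)
Definition two_state X a b (z : R * R) : R := if z.1 < X z.2 then a z.2 else b z.2.

Variables (X a b : R -> R) (g : R * R -> R) (L M : R).
Hypotheses (cX : continuous X) (ca : continuous a) (cb : continuous b)
  (cg : continuous g).
Hypothesis (XL : forall t : R, t \in `[0, M] -> `|X t| < L).
Hypothesis g_box : forall z, g z != 0 -> `|z.1| < L /\ 0 < z.2 < M.

Let h z := two_state X a b z * g z.

Let h0 z : g z = 0 -> h z = 0. Proof. by rewrite /h => ->; rewrite mulr0. Qed.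

Let h_box z : h z != 0 -> `|z.1| < L /\ 0 < z.2 < M.
Proof. by move=> hz; apply: g_box; apply: contra_neq hz; exact: h0. Qed.

Let mh : measurable_fun [set: measurableTypeR R * measurableTypeR R] h.
Proof.
apply: measurable_funM; last exact: continuous_measurable_fun2.
have m2 (f : R -> R) : continuous f ->
    measurable_fun [set: measurableTypeR R * measurableTypeR R] (fun z => f z.2).
  move=> cf; apply: measurableT_comp; last exact: measurable_snd.
  exact: continuous_measurable_fun.
apply: measurable_fun_ifT; [|exact: m2|exact: m2].
by apply: measurable_fun_ltr; [exact: measurable_fst|exact: m2].
Qed.

Let h_bounded : exists2 C : R, 0 < C & forall z, `|h z| <= C.
Proof.
have [|A A0 aA] := @compact_norm_bounded _ _ `[0, M] a (@segment_compact _ _ _).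
  exact: continuous_subspaceT.
have [|B B0 bB] := @compact_norm_bounded _ _ `[0, M] b (@segment_compact _ _ _).
  exact: continuous_subspaceT.
have [||C C0 gC] := @vanishes_off_bounded _ (`[- L, L] `*` `[0, M]) g _ cg.
- by apply: compact_setX; exact: segment_compact.
- move=> z; apply: contra_notP => /eqP/g_box[zL /andP[z0 zM]].
  by split => /=; rewrite in_itv/= -?ler_norml ?ltW.
exists (Num.max A B * C); first by rewrite mulr_gt0// lt_max A0.
move=> z; have [->|hz] := eqVneq (h z) 0.
  by rewrite normr0 mulr_ge0// ltW// lt_max A0.
have [_ /andP[z0 zM]] := h_box hz.
have z2 : `[0, M]%classic z.2 by rewrite /= in_itv/= !ltW.
rewrite normrM ler_pM// /two_state le_max; case: ifPn => _.
  by rewrite (ltW (aA _ z2)).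
by rewrite (ltW (bB _ z2)) orbT.
Qed.

Let integrable_bounded d (T : measurableType d) (m : {measure set T -> \bar R})
    (D : set T) (f : T -> R) (C : R) : measurable D -> (m D < +oo)%E ->
  measurable_fun D f -> (forall x, `|f x| <= C) -> m.-integrable D (EFin \o f).
Proof.
move=> mD Doo mf fC; apply: measurable_bounded_integrable => //.
exists C; split; first exact: num_real.
by move=> y Cy x _ /=; rewrite (le_trans (fC x)) ?ltW.
Qed.

Let mu_itv_fin c d : (mu `[c, d] < +oo)%E.
Proof.
by rewrite lebesgue_measure_itv/=; case: ifPn => _; rewrite ?ltry// -EFinB ltry.
Qed.

(** [h] is bounded and measurable, and vanishes off a box of finite measure. *)
Let integrable_h : mu2.-integrable setT (EFin \o h).
Proof.
have [C C0 hC] := h_bounded.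
have mB : measurable ((`[- L, L] : set (measurableTypeR R)) `*`
    (`[0, M] : set (measurableTypeR R))).
  by apply: measurableX; exact: measurable_itv.
have -> : EFin \o h = (EFin \o h) \_ (`[- L, L] `*` `[0, M]).
  apply/funext => z; rewrite patchE; case: ifPn => //=.
  rewrite notin_setE => Bz; congr (_%:E); apply/eqP; apply: contra_notT Bz.
  move=> /h_box[zL /andP[z0 zM]].
  by split => /=; rewrite in_itv/= -?ler_norml ?ltW.
apply/(integrable_mkcond _ mB). apply: (@integrable_bounded _ _ mu2 _ h C) => //.
  rewrite [X in (X < _)%E](_ : _ = mu `[(- L)%R, L] * mu `[0%R, M])%E; last first.
    by apply: product_measure1E; exact: measurable_itv.
  by apply: lte_mul_pinfty => //; rewrite ge0_fin_numE.
exact: measurable_funTS.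
Qed.

(** The inner integral over [[- L, L]] at time [t], cut at the front. *)
Definition two_state_slice t : R :=
  a t * slice_integral L g (X t) t +
  b t * (slice_integral L g L t - slice_integral L g (X t) t).

Let integrable_h_slice t c d : mu.-integrable `[c, d] (EFin \o (fun x => h (x, t))).
Proof.
have [C C0 hC] := h_bounded.
apply: (@integrable_bounded _ _ _ _ _ C) => //; first exact: mu_itv_fin.
apply: measurable_funTS; exact: (measurableT_comp mh (measurable_pair2 t)).
Qed.

Let slice_of_h t : t \in `[0, M] ->
  \int[mu]_(x in `[- L, L]) h (x, t) = two_state_slice t.
Proof.
move=> /XL /[!ltr_norml]/andP[LX XL'].
have := @Rintegral_itvB R (fun x => h (x, t)) (BLeft (- L)) (BRight L) (X t).
rewrite !bnd_simp => /(_ (integrable_h_slice _ _ _) (ltW LX) (ltW XL')).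
move=> /eqP; rewrite subr_eq => /eqP ->; rewrite addrC; congr (_ + _).
  (* On the front itself [two_state] takes the right value [b], so the left piece drops its right
     endpoint, a null set. *)
  rewrite -Rintegral_itv_bndo_bndc; last first.
    apply: integrableS (integrable_h_slice t (- L) (X t)) => //.
    by apply: subset_itvl; rewrite bnd_simp.
  rewrite (_ : slice_integral _ _ _ _ = \int[mu]_(x in `[- L, X t[) g (x, t)).
    rewrite -RintegralZl//; last first.
      apply: integrableS (integrable_slice (- L) (X t) t cg) => //.
      by apply: subset_itvl; rewrite bnd_simp.
    apply: eq_Rintegral => x; rewrite inE/= in_itv/= => /andP[_ xX].
    by rewrite /h /two_state/= xX.
  rewrite Rintegral_itv_bndo_bndc//.
  apply: integrableS (integrable_slice (- L) (X t) t cg) => //.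
  by apply: subset_itvl; rewrite bnd_simp.
rewrite Rintegral_itvB; [|exact: integrable_slice|by rewrite bnd_simp ltW..].
rewrite -RintegralZl//; last first.
  apply: integrableS (integrable_slice (X t) L t cg) => //.
  by apply: subset_itvr; rewrite bnd_simp.
apply: eq_Rintegral => x; rewrite inE/= in_itv/= => /andP[Xx _].
by rewrite /h /two_state/= ltNge ltW.
Qed.

(** Fubini's theorem, integrating over [x] first. The integrand vanishes outside [|x| < L],
    [0 < t < M], so passing between the half-plane, the plane and the box changes nothing. *)
Lemma Rintegral_two_state :
  \int[mu2]_(z in setT `*` `]0, +oo[) (two_state X a b z * g z) =
  \int[mu]_(t in `[0, M]) two_state_slice t.
Proof.
rewrite Rintegral_mkcond.
have -> : (fun z => two_state X a b z * g z) \_ (setT `*` `]0, +oo[) = h.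
  apply/funext => z; rewrite patchE; case: ifPn => //.
  rewrite notin_setE => Bz; apply/esym/eqP; apply: contra_notT Bz.
  by move=> /h_box[_ /andP[z0 _]]; split => //=; rewrite in_itv/= z0.
rewrite /Rintegral -(integral21_prod_meas1 integrable_h).
rewrite [in RHS]integral_mkcond; congr (fine _); apply: eq_integral => t _.
rewrite /fubini_G patchE.
have hE : (\int[mu]_x (EFin \o h) (x, t) = (\int[mu]_(x in `[- L, L]) h (x, t))%:E)%E.
  rewrite /Rintegral fineK; last first.
    apply: integrable_fin_num => //; exact: integrable_h_slice.
  rewrite [in RHS]integral_mkcond; apply: eq_integral => x _ /=.
  rewrite patchE; case: ifPn => //.
  rewrite notin_setE => Bz; congr (_%:E); apply/eqP; apply: contra_notT Bz.
  by move=> /h_box[zL _]; rewrite /= in_itv/= -ler_norml ltW.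
rewrite hE; case: ifPn => [|]; first by rewrite inE => /slice_of_h ->.
rewrite notin_setE => tM; congr (_%:E).
rewrite (@eq_Rintegral _ _ _ _ _ (cst 0)).
  by rewrite Rintegral_cst// mul0r.
move=> x _ /=; apply/eqP; apply: contra_notT tM => /h_box[_ /andP[t0 tM]].
by rewrite /= in_itv/= !ltW.
Qed.

Lemma Rintegral_along (c : R -> R) :
  \int[mu]_(t in `]0, +oo[) (c t * g (X t, t)) =
  \int[mu]_(t in `[0, M]) (c t * g (X t, t)).
Proof.
rewrite Rintegral_mkcond [RHS]Rintegral_mkcond; congr Rintegral.
apply/funext => t; rewrite !patchE.
have [->|/g_box[_ /=/andP[t0 tM]]] := eqVneq (g (X t, t)) 0.
  by rewrite mulr0 !if_same.
by rewrite !mem_set//= in_itv/= ?ltW// t0.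
Qed.

End two_states.

(** * The weak balance law for a front carrying a Dirac mass *)

Section balance_law.
Variable R : realType.
Local Notation mu := (@lebesgue_measure R).
Local Notation mu2 := (mu \x mu)%E.
Implicit Types (K : set (R * R)) (g psi : R * R -> R) (X a b c p q : R -> R).

(** The regularity needed to differentiate a slice integral along a curve; a test function and both
    its first partial derivatives have it. *)
Definition C1_in_time K g := [/\ continuous g, forall z, derivable g z (0, 1),
  continuous (partial_t g) & vanishes_off K g].

(** Leibniz rule with a moving upper limit: the chain rule combines the fundamental theorem of
    calculus in [x] with differentiation under the integral sign in [t]. *)
Lemma is_derive_slice_along K g X (L t X' : R) : compact K -> C1_in_time K g ->
  is_derive t 1 X X' -> - L < X t ->
  is_derive t 1 (fun t => slice_integral L g (X t) t)
    (g (X t, t) * X' + slice_integral L (partial_t g) (X t) t).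
Proof.
move=> cK [cg dg cdg gK] dX LX.
have Kcl : closed K by apply: compact_closed => //; exact: Rhausdorff.
have [C _ gC] := vanishes_off_bounded cK cdg (vanishes_off_derive _ Kcl gK).
apply: (@is_derive_along _ (slice_integral L g) (fun x t => g (x, t)) X (- L)) => //.
- by move=> x s Lx; exact: is_derive_slice_integral_x.
- have -> : (fun z : R * R => g (z.1, z.2)) = g by apply/funext => -[].
  exact: cg.
- exact: is_derive_slice_integral_t gC.
Qed.

Lemma slice_integral_partial_x psi (L x t : R) :
  (forall z, derivable psi z (1, 0)) -> continuous (partial_x psi) -> - L < x ->
  slice_integral L (partial_x psi) x t = psi (x, t) - psi (- L, t).
Proof.
move=> dx cdx Lx; rewrite /slice_integral /Rintegral.
have D (y : R) : is_derive y 1 (fun s => psi (s, t)) (partial_x psi (y, t)).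
  exact: is_derive_partial_x.
have C (y : R) : {for y, continuous (fun s => psi (s, t))}.
  by apply: differentiable_continuous; apply/derivable1_diffP; case: (D y).
rewrite (@continuous_FTC2 R (fun s => partial_x psi (s, t)) (fun s => psi (s, t))) //.
- by apply: continuous_subspaceT; exact: continuous_pairl.
- split; first by move=> y _; case: (D y).
    by apply: cvg_at_right_filter; exact: C.
  by apply: cvg_at_left_filter; exact: C.
- by move=> y _; rewrite derive1E; case: (D y).
Qed.

(** Both coordinates are bounded on the compact support; a single [M] serves as spatial bound and as
    time horizon. *)
Lemma test_function_box psi : test_function psi -> exists K, [/\ compact K,
  vanishes_off K psi &
  exists2 M : R, 0 < M & forall z, K z -> `|z.1| < M /\ 0 < z.2 < M].
Proof.
move=> [_ [cK K0]]; exists (closure [set z | psi z != 0]); split => //.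
  move=> z Kz; apply/eqP; apply: contra_notT Kz => psiz.
  exact: subset_closure.
have [|A A0 KA] := compact_norm_bounded (f := fst) cK.
  by apply: continuous_subspaceT => z; exact: cvg_fst.
have [|B B0 KB] := compact_norm_bounded (f := snd) cK.
  by apply: continuous_subspaceT => z; exact: cvg_snd.
exists (Num.max A B); first by rewrite lt_max A0.
move=> z Kz; rewrite !lt_max KA//= (K0 _ Kz) orbC.
by rewrite (le_lt_trans (ler_norm _) (KB _ Kz)).
Qed.

(** [a], [b] are the densities to the left and right of the front, [p], [q] the fluxes, [c] the
    Dirac weight, and [k] times [e1], [e2], [e] the sources. The hypothesis on the derivative of [c]
    is the generalized Rankine-Hugoniot condition. *)
Variables (psi : R * R -> R) (X X' a b c p q e1 e2 e : R -> R) (k : R).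
Hypotheses (psi_test : test_function psi)
  (dX : forall t : R, is_derive t 1 X (X' t)) (cX' : continuous X')
  (da : forall t : R, is_derive t 1 a (k * e1 t)) (ce1 : continuous e1)
  (db : forall t : R, is_derive t 1 b (k * e2 t)) (ce2 : continuous e2)
  (dc : forall t : R, is_derive t 1 c
     (X' t * (b t - a t) - (q t - p t) + k * e t)) (ce : continuous e)
  (cp : continuous p) (cq : continuous q).

(* Each of the three pairings is the integral over [0, M] of an expression in
   slice integrals; the sum of these expressions is the time derivative of
   [a S(X) + b (S(L) - S(X)) + c psi(X)], where S is the slice integral of psi,
   and this function vanishes at both ends. *)
Lemma front_balance_law :
  \int[mu2]_(z in setT `*` `]0, +oo[) (two_state X a b z * partial_t psi z) +
    \int[mu]_(t in `]0, +oo[) (c t * partial_t psi (X t, t)) +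
  (\int[mu2]_(z in setT `*` `]0, +oo[) (two_state X p q z * partial_x psi z) +
    \int[mu]_(t in `]0, +oo[) (c t * X' t * partial_x psi (X t, t))) +
  k * (\int[mu2]_(z in setT `*` `]0, +oo[) (two_state X e1 e2 z * psi z) +
    \int[mu]_(t in `]0, +oo[) (e t * psi (X t, t))) = 0.
Proof.
have cont (f f' : R -> R) : (forall t : R, is_derive t 1 f (f' t)) -> continuous f.
  move=> df t; apply: differentiable_continuous; apply/derivable1_diffP.
  by case: (df t).
have [[[cX ca] cb] cc] := (cont _ _ dX, cont _ _ da, cont _ _ db, cont _ _ dc).
have [K [cK psiK [M M0 KM]]] := test_function_box psi_test.
have Kcl : closed K by apply: compact_closed => //; exact: Rhausdorff.
(* Order two is used because slice integrals of the first partial derivatives are themselves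
   differentiated in time, to obtain their continuity. *)
have [cpsi [dx [dt [[cpx [_ [dxt [_ [cxt _]]]]]
  [cpt [_ [dtt [_ [ctt _]]]]]]]]] := psi_test.1 2.
have pxK : vanishes_off K (partial_x psi) by exact: vanishes_off_derive.
have ptK : vanishes_off K (partial_t psi) by exact: vanishes_off_derive.
have [|B B0 XB] := @compact_norm_bounded _ _ `[0, M] X (@segment_compact _ _ _).
  exact: continuous_subspaceT.
(* [L] lies beyond both the support of [psi] and the front during [[0, M]]. *)
pose L := Num.max M B.
have ML : M <= L by rewrite le_max lexx.
have XL t : t \in `[0, M] -> `|X t| < L by move=> tM; rewrite lt_max XB ?orbT.
have LX t : t \in `[0, M] -> - L < X t by move=> /XL; rewrite ltr_norml => /andP[].
have L0 : 0 < L by exact: lt_le_trans ML.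
have box g : vanishes_off K g -> forall z, g z != 0 -> `|z.1| < L /\ 0 < z.2 < M.
  move=> gK z gz; have [|zM ?] := KM z; last by split => //; exact: lt_le_trans ML.
  by apply: contrapT => /gK/eqP; rewrite (negbTE gz).
have psiL s t : L <= `|s| -> psi (s, t) = 0.
  by apply: contraTeq => /(box _ psiK)[]; rewrite -ltNge.
have psi0 s t : t \notin `]0, M[ -> psi (s, t) = 0.
  by apply: contraNeq => /(box _ psiK)[_] /=; rewrite in_itv.
have Cpsi : C1_in_time K psi by split.
have Cpx : C1_in_time K (partial_x psi) by split.
have Cpt : C1_in_time K (partial_t psi) by split.
(* The time integrand to which Fubini's theorem reduces one pairing. *)
pose line a b c g t := two_state_slice X a b g L t + c t * g (X t, t).
have cont_line a0 b0 c0 g : continuous a0 -> continuous b0 -> continuous c0 ->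
    C1_in_time K g -> {within `[0, M], continuous (line a0 b0 c0 g)}.
  move=> ca0 cb0 cc0 Cg.
  have cS : {within `[0, M], continuous (fun t => slice_integral L g (X t) t)}.
    apply: derivable_within_continuous => t tM.
    by have [] := is_derive_slice_along cK Cg (dX t) (LX _ tM).
  have cSL : {within `[0, M], continuous (fun t => slice_integral L g L t)}.
    apply: derivable_within_continuous => t tM.
    (* The integral over the full width is treated as a slice integral along the constant curve
       [L]. *)
    have LL : - L < cst L t by rewrite /= gtrN.
    by have [] := is_derive_slice_along cK Cg (is_derive_cst L t 1) LL.
  have [cg _ _ _] := Cg.
  have cW (f : R -> R) : continuous f -> {within `[0, M], continuous f}.
    by move=> cf; exact: continuous_subspaceT.
  move=> t; apply: cvgD; first apply: cvgD.
  - by apply: cvgM; [exact: cW|exact: cS].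
  - by apply: cvgM; [exact: cW|apply: cvgB; [exact: cSL|exact: cS]].
  - apply: cvgM; first exact: cW.
    by apply: (cW (fun t => g (X t, t))); exact: continuous_along.
have pair_line a0 b0 c0 g : continuous a0 -> continuous b0 -> continuous c0 ->
    C1_in_time K g ->
    \int[mu2]_(z in setT `*` `]0, +oo[) (two_state X a0 b0 z * g z) +
      \int[mu]_(t in `]0, +oo[) (c0 t * g (X t, t)) =
    \int[mu]_(t in `[0, M]) line a0 b0 c0 g t.
  move=> ca0 cb0 cc0 Cg; have [cg _ _ gK] := Cg.
  rewrite (Rintegral_two_state cX ca0 cb0 cg XL (box _ gK)).
  rewrite (Rintegral_along X (box _ gK)) -RintegralD//.
  - apply: continuous_compact_integrable; first exact: segment_compact.
    have lE : line a0 b0 (cst 0) g = two_state_slice X a0 b0 g L.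
      by apply/funext => t; rewrite /line mul0r addr0.
    by rewrite -lE; apply: cont_line => // t; exact: cvg_cst.
  - apply: continuous_compact_integrable; first exact: segment_compact.
    apply: continuous_subspaceT => t; apply: cvgM; first exact: cc0.
    by apply: (@continuous_along _ g X).
have ccX' : continuous (fun t => c t * X' t).
  by move=> t; apply: cvgM; [exact: cc|exact: cX'].
have sum_eq (x y z u v w : R) : x = u -> y = v -> z = w ->
    u + v + k * w = 0 -> x + y + k * z = 0 by move=> -> -> ->.
apply: (sum_eq _ _ _ _ _ _ (pair_line a b c _ ca cb cc Cpt)
  (pair_line p q _ _ cp cq ccX' Cpx) (pair_line e1 e2 e _ ce1 ce2 ce Cpsi)).
set l1 := line _ _ _ _; set l2 := line _ _ _ _; set l3 := line _ _ _ _.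
have c1 : {within `[0, M], continuous l1} by exact: cont_line.
have c2 : {within `[0, M], continuous l2} by exact: cont_line.
have c3 : {within `[0, M], continuous l3} by exact: cont_line.
have c3k : {within `[0, M], continuous (fun t => k * l3 t)}.
  by move=> t; apply: cvgM; [exact: cvg_cst|exact: c3].
have c12 : {within `[0, M], continuous (fun t => l1 t + l2 t)}.
  by move=> t; apply: cvgD; [exact: c1|exact: c2].
have c123 : {within `[0, M], continuous (fun t => l1 t + l2 t + k * l3 t)}.
  by move=> t; apply: cvgD; [exact: c12|exact: c3k].
have intc (f : R -> R) : {within `[0, M], continuous f} ->
    mu.-integrable `[0, M] (EFin \o f).
  by apply: continuous_compact_integrable; exact: segment_compact.
pose E t := a t * slice_integral L psi (X t) t +
  b t * (slice_integral L psi L t - slice_integral L psi (X t) t) +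
  c t * psi (X t, t).
have dE t : t \in `[0, M] -> is_derive t 1 E (l1 t + l2 t + k * l3 t).
  move=> tM.
  have dS := is_derive_slice_along cK Cpsi (dX t) (LX _ tM).
  have LL : - L < cst L t by rewrite /= gtrN.
  have dSL := is_derive_slice_along cK Cpsi (is_derive_cst L t 1) LL.
  have dpsi : is_derive t 1 (fun t => psi (X t, t))
      (partial_x psi (X t, t) * X' t + partial_t psi (X t, t)).
    apply: (@is_derive_along _ (fun x t => psi (x, t))
      (fun x t => partial_x psi (x, t)) X (X t - 1)).
    - by rewrite gtrBl.
    - by move=> x s _; apply: is_derive_partial_x; exact: dx.
    - have -> : (fun z : R * R => partial_x psi (z.1, z.2)) = partial_x psi.
        by apply/funext => -[].
      exact: cpx.
    - by apply: is_derive_partial_t; exact: dt.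
  have dsum := is_deriveD (is_deriveD (is_deriveM (da t) dS)
    (is_deriveM (db t) (is_deriveB dSL dS))) (is_deriveM (dc t) dpsi).
  apply: (is_derive_eq dsum).
  (* As [psi] vanishes at [- L], integrating its [x] derivative gives back [psi]; this produces the
     flux terms at the front. *)
  have Sx x : - L < x -> slice_integral L (partial_x psi) x t = psi (x, t).
    move=> Lx; rewrite (slice_integral_partial_x _ dx cpx Lx) (psiL (- L)) ?subr0//.
    by rewrite normrN ler_norm.
  have SxL : slice_integral L (partial_x psi) L t = 0.
    by rewrite Sx ?gtrN// psiL// ler_norm.
  have l2E : l2 t = p t * psi (X t, t) + q t * (0 - psi (X t, t)) +
      c t * X' t * partial_x psi (X t, t).
    by rewrite /l2 /line /two_state_slice SxL (Sx _ (LX _ tM)).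
  (* The terms [X' * (a - b) * psi] from the moving limit cancel against the derivative of [c],
     whose remaining part supplies the flux jump and the source on the front. *)
  rewrite l2E /l1 /l3 /line /two_state_slice !fctE /GRing.scale/=; ring.
have E0 t : t \notin `]0, M[ -> E t = 0.
  move=> tM; have S0 x : slice_integral L psi x t = 0.
    rewrite /slice_integral (@eq_Rintegral _ _ _ _ _ (cst 0)); last first.
      by move=> s _; exact: psi0.
    by rewrite Rintegral_cst// mul0r.
  by rewrite /E !S0 psi0// subrr !mulr0 !addr0.
suff key : \int[mu]_(t in `[0, M]) (l1 t + l2 t + k * l3 t) = 0.
  have mI : measurable (`[0, M] : set (measurableTypeR R)) by exact: measurable_itv.
  have I123 := RintegralD mI (intc _ c12) (intc _ c3k).
  have I12 := RintegralD mI (intc _ c1) (intc _ c2).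
  have I3 := RintegralZl k mI (intc _ c3).
  by rewrite -I3 -I12 -I123.
rewrite /Rintegral (@continuous_FTC2 _ (fun t => l1 t + l2 t + k * l3 t) E) //.
- by rewrite !E0 ?subee// in_itv/= ltxx ?andbF.
- have cE t : t \in `[0, M] -> {for t, continuous E}.
    move=> tM; apply: differentiable_continuous; apply/derivable1_diffP.
    by case: (dE _ tM).
  split.
  + by move=> t tM; case: (dE t (subset_itv_oo_cc tM)).
  + by apply: cvg_at_right_filter; apply: cE; rewrite in_itv/= lexx ltW.
  + by apply: cvg_at_left_filter; apply: cE; rewrite in_itv/= lexx ltW.
- by move=> t tM; rewrite derive1E; case: (dE t (subset_itv_oo_cc tM)).
Qed.

End balance_law.

(** * Derivatives relative to the half-line, and quadratic functions of time *)

Section derivatives_on_the_half_line.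
Variable R : realType.
Implicit Types (f g : R -> R) (t l : R).

Lemma is_derive_has_derivative_ge0 f t l :
  is_derive t 1 f l -> has_derivative_ge0 f t l.
Proof.
move=> /is_derive_cvgP df; apply: cvg_trans df; apply: cvg_app.
by apply: within_subset => h /= [].
Qed.

(** At a positive time every small [h] satisfies [0 <= t + h]. *)
Lemma has_derivative_ge0_is_derive f t l :
  0 < t -> has_derivative_ge0 f t l -> is_derive t 1 f l.
Proof.
move=> t0 df; apply/is_derive_cvgP; apply: cvg_trans df; apply: cvg_app.
move=> P PD.
have th : \forall h \near nbhs (0 : R), 0 <= t + h.
  near=> h; rewrite addrC -lerBlDr sub0r ltW//; near: h.
  by apply: lt_nbhsr; rewrite oppr_lt0.
have {}PD : \forall h \near nbhs (0 : R), h != 0 /\ 0 <= t + h -> P h by exact: PD.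
suff : \forall h \near nbhs (0 : R), h != 0 -> P h by [].
by apply: filterS2 PD th => h PD th h0; exact: PD.
Unshelve. all: end_near. Qed.

Lemma eq_has_derivative_ge0 f g t l : 0 <= t ->
  (forall s, 0 <= s -> f s = g s) ->
  has_derivative_ge0 f t l -> has_derivative_ge0 g t l.
Proof.
move=> t0 fg; apply: cvg_trans; apply: near_eq_cvg.
suff : \forall h \near nbhs (0 : R), h != 0 /\ 0 <= t + h ->
    h^-1 * (f (t + h) - f t) = h^-1 * (g (t + h) - g t) by [].
by apply: nearW => h [_ th]; rewrite (fg _ t0) (fg _ th).
Qed.

(** The difference [f - g] has zero derivative at positive times and is right continuous at 0, so
    the mean value theorem makes it constant. *)
Lemma has_derivative_ge0_unique f g g' : f 0 = g 0 ->
  (forall t, 0 <= t -> has_derivative_ge0 f t (g' t)) ->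
  (forall t : R, is_derive t 1 g (g' t)) ->
  forall t, 0 <= t -> f t = g t.
Proof.
move=> fg0 df dg t; rewrite le_eqVlt => /predU1P[<-//|t0].
pose k s := f s - g s.
have dk (s : R) : 0 < s -> is_derive s 1 k 0.
  move=> s0; have dfs := has_derivative_ge0_is_derive s0 (df _ (ltW s0)).
  by apply: (is_derive_eq (is_deriveB dfs (dg s))); rewrite subrr.
have ck : {within `[0, t], continuous k}.
  apply/(continuous_within_itvP _ t0).
  have cs (s : R) : 0 < s -> {for s, continuous k}.
    move=> s0; apply: differentiable_continuous; apply/derivable1_diffP.
    by case: (dk s s0).
  split.
  - by move=> s /[!in_itv]/= /andP[s0 _]; exact: cs.
  - have df0 := df 0 (lexx _).
    have dr : h^-1 * (f (0 + h) - f 0) @[h --> 0^'+] --> g' 0.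
      apply: cvg_trans df0; apply: cvg_app; apply: within_subset => h /= h0.
      by rewrite gt_eqF// add0r ltW.
    have id0 : h @[h --> (0 : R)^'+] --> (0 : R).
      exact/cvg_at_right_filter/cvg_id.
    (* Right continuity comes from the right derivative: [f h] is [h] times the difference quotient
       plus [f 0]. *)
    have lim : h * (h^-1 * (f (0 + h) - f 0)) + f 0 @[h --> (0 : R)^'+] --> f 0.
      have e : 0 * g' 0 + f 0 = f 0 by rewrite mul0r add0r.
      by rewrite -[X in _ --> X]e; exact: cvgD (cvgM id0 dr) (cvg_cst _).
    have fr : f h @[h --> (0 : R)^'+] --> f 0.
      apply: cvg_trans lim; apply: near_eq_cvg.
      near=> h.
      have h0 : 0 < h by near: h; exact: nbhs_right_gt.
      by rewrite add0r mulrA divff ?gt_eqF// mul1r subrK.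
    have gr : g h @[h --> (0 : R)^'+] --> g 0.
      apply: cvg_at_right_filter.
      by apply: differentiable_continuous; apply/derivable1_diffP; case: (dg 0).
    exact: cvgB fr gr.
  - by apply: cvg_at_left_filter; exact: cs.
have [|s _] := @MVT _ k (cst 0) 0 t t0 _ ck.
  by move=> s /[!in_itv]/= /andP[s0 _]; exact: dk.
by rewrite /k fg0 subrr mul0r subr0 => /eqP; rewrite subr_eq0 => /eqP.
Unshelve. all: end_near. Qed.

(** The front, its weight and momentum, and the densities and fluxes on both sides are all
    polynomials of degree at most two in time. *)
Lemma is_derive_quadratic (x y z : R) f t :
  (forall s, f s = x + y * s + z * s ^+ 2) -> is_derive t 1 f (y + 2 * z * t).
Proof.
move=> fE; have -> : f = (fun s => x + y * s + z * s ^+ 2) by apply/funext.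
apply: is_derive_eq; rewrite /GRing.scale/=. ring.
Qed.

Lemma continuous_quadratic (x y z : R) f :
  (forall s, f s = x + y * s + z * s ^+ 2) -> continuous f.
Proof.
move=> fE t; apply: differentiable_continuous; apply/derivable1_diffP.
by case: (is_derive_quadratic t fE).
Qed.

Lemma smooth_ge0_quadratic (x y z : R) f :
  (forall t, 0 <= t -> f t = x + y * t + z * t ^+ 2) -> smooth_ge0 f.
Proof.
(* Index 0 must be [f] itself, which is known to be a polynomial only on the half-line. *)
move=> fE; exists (fun n => match n with
  | 0 => f | 1 => fun t => y + 2 * z * t | 2 => cst (2 * z) | _ => cst 0 end).
split => // -[|[|n]] t t0.
- apply: (@eq_has_derivative_ge0 (fun t => x + y * t + z * t ^+ 2)) => //.
    by move=> s s0; rewrite fE.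
  exact/is_derive_has_derivative_ge0/is_derive_quadratic.
- apply: is_derive_has_derivative_ge0.
  have -> : cst (2 * z) t = 2 * z + 2 * 0 * t by rewrite /=; ring.
  by apply: (@is_derive_quadratic y) => s; ring.
- apply: is_derive_has_derivative_ge0.
  by case: n => [|n]; exact: is_derive_cst.
Qed.

End derivatives_on_the_half_line.

(** * The quadratic equation for the strength, and the signs in the entropy condition *)

Section algebra.
Variable R : realType.

(** Brings the terms of [w0] with exponent [alpha - 1] into the form used in the quadratic
    equation. *)
Lemma over_powR_subr1 (A r s : R) : 0 < r -> A / r `^ (s - 1) = r * (A / r `^ s).
Proof.
move=> r0; have rs0 : r `^ s != 0 by rewrite gt_eqF// powR_gt0.
rewrite powRB; last by rewrite (gt_eqF r0) implybT.
by rewrite (powRr1 (ltW r0)); field; rewrite rs0 gt_eqF.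
Qed.

(* The admissible strength is the root of c^2 + D c = Q with c > 0; since
   Q > 0, the other root is negative. *)
Lemma positive_root (D Q : R) : 0 < Q ->
  let s := Num.sqrt (Q + 4^-1 * D ^+ 2) - 2^-1 * D in
  [/\ 0 < s, s ^+ 2 + D * s = Q & forall c, 0 < c -> c ^+ 2 + D * c = Q -> c = s].
Proof.
move=> Q0 s.
have disc0 : 0 <= Q + 4^-1 * D ^+ 2 by have := sqr_ge0 D; lra.
set r := Num.sqrt _ in s *.
have r0 : 0 <= r by exact: sqrtr_ge0.
have r2 : r ^+ 2 = Q + 4^-1 * D ^+ 2 by exact: sqr_sqrtr.
have sQ : s ^+ 2 + D * s = Q by rewrite /s -[RHS](addrK (4^-1 * D ^+ 2)) -r2; field.
split => //.
  (* If [s <= 0] then [D >= 0], and both factors of [- s * (s + D)] are nonnegative, although the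
     product is [- Q]. *)
  rewrite ltNge; apply/negP => s0; have : 0 <= - s * (s + D).
    by apply: mulr_ge0; rewrite /s in s0 *; lra.
  have -> : - s * (s + D) = - Q by rewrite -sQ; ring.
  by move=> ?; lra.
(* Completing the square gives [(c + D / 2) ^+ 2] under the root; [c] and [c + D] are positive,
   hence so is their mean. *)
move=> c c0 cQ; rewrite /s; apply/eqP; rewrite -(inj_eq (addIr (2^-1 * D))) subrK.
rewrite /r -cQ (_ : c ^+ 2 + D * c + 4^-1 * D ^+ 2 = (c + 2^-1 * D) ^+ 2); last by field.
rewrite sqrtr_sqr ger0_norm//.
have : 0 < c * (c + D) by rewrite (_ : _ * _ = Q)// -cQ; ring.
by rewrite pmulr_rgt0// => ?; lra.
Qed.

(** Here [a] and [b] stand for the two gaps [v - up] and [um - Pm - v] of the entropy condition, the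
    equation for the momentum condition, and the last hypothesis for a positive strength. If one gap
    is not positive, the other is, and the equation fixes the sign of [a + Pp] or [b + Pm]. *)
Lemma overcompressive_root (a b rm rp Pm Pp : R) :
  0 < rm -> 0 < rp -> 0 < Pm -> 0 < Pp -> 0 < a + b ->
  rp * a * (a + Pp) = rm * b * (b + Pm) -> 0 < rp * a + rm * (b + Pm) ->
  0 < a /\ 0 < b.
Proof.
move=> rm0 rp0 Pm0 Pp0 ab E c0; split; rewrite ltNge; apply/negP => le0.
  have b0 : 0 < b by lra.
  have bP : 0 < rm * b * (b + Pm) by rewrite !mulr_gt0//; lra.
  have aP : a + Pp < 0.
    rewrite ltNge; apply/negP => aP; move: bP; rewrite -E ltNge => /negP; apply.
    by rewrite -mulrA pmulr_rle0//; exact: mulr_le0_ge0.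
  (* The right sides of [h1] and [h2] add up to the difference of the two sides of [E], which is
     zero. *)
  have h1 : 0 < (rp * a + rm * (b + Pm)) * - (a + Pp) by rewrite mulr_gt0//; lra.
  have h2 : 0 < rm * (b + Pm) * (b + a + Pp) by rewrite !mulr_gt0//; lra.
  lra.
have a0 : 0 < a by lra.
have aP : 0 < rp * a * (a + Pp) by rewrite !mulr_gt0//; lra.
have bP : b + Pm < 0.
  rewrite ltNge; apply/negP => bP; move: aP; rewrite E ltNge => /negP; apply.
  by rewrite -mulrA pmulr_rle0//; exact: mulr_le0_ge0.
have h1 : 0 < (rp * a + rm * (b + Pm)) * (a + Pp) by rewrite mulr_gt0//; lra.
have h2 : 0 < rm * - (b + Pm) * (a + b + Pp) by rewrite !mulr_gt0//; lra.
lra.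
Qed.

End algebra.

(** * Strength and speed of the delta shock *)

Section delta_shock.
Variable R : realType.
Variables (A alpha beta rhom rhop um up : R).
Hypotheses (A0 : 0 < A) (rhom0 : 0 < rhom) (rhop0 : 0 < rhop)
  (hu : up < um - A / rhom `^ alpha) (hrho : rhop != rhom).

Local Notation Pm := (A / rhom `^ alpha).
Local Notation Pp := (A / rhop `^ alpha).
Local Notation jmp := (jump beta rhom rhop um up).
Local Notation pair_ := (pairing beta rhom rhop um up).

Let Pm0 : 0 < Pm. Proof. by rewrite divr_gt0// powR_gt0. Qed.
Let Pp0 : 0 < Pp. Proof. by rewrite divr_gt0// powR_gt0. Qed.

Definition strength (v : R) : R :=
  v * (rhop - rhom) - (rhop * up - rhom * um).

(** The shift [beta * t], common to all velocities, cancels, so the weight grows at a constant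
    rate. *)
Lemma jump_mass_balance v t :
  (v + beta * t) * jmp (@mass R) t - jmp (@mass_flux R) t = strength v.
Proof. by rewrite /jump /mass /mass_flux /strength; ring. Qed.

(* Vanishing of this expression is the momentum Rankine-Hugoniot condition for
   the initial speed v. *)
Definition momentum_defect (v : R) : R :=
  rhop * (v - up) * (v - up + Pp) - rhom * (v - um) * (v - um + Pm).

(** After adding [beta * w] with [w] equal to [strength v * t], the right side is the derivative of
    [w * (v + beta * t)] minus the defect. *)
Lemma jump_momentum_balance v t :
  (v + beta * t) * jmp (momentum A alpha) t - jmp (momentum_flux A alpha) t =
  strength v * (v + beta * t) - momentum_defect v.
Proof.
by rewrite /jump /momentum /momentum_flux /strength /momentum_defect; ring.
Qed.

Let D := rhop * Pp - rhom * Pm.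
Let Q := rhop * rhom * (up - um) * ((up - um) - (Pp - Pm)).

Lemma strength_quadratic v :
  (rhop - rhom) * momentum_defect v = strength v ^+ 2 + D * strength v - Q.
Proof. by rewrite /momentum_defect /strength /D /Q; ring. Qed.

Let w_ := w0 A alpha rhom rhop um up.
Let v_ := vdelta A alpha rhom rhop um up.

Lemma w0_root : [/\ 0 < w_, w_ ^+ 2 + D * w_ = Q &
  forall c, 0 < c -> c ^+ 2 + D * c = Q -> c = w_].
Proof.
(* [Q] is [rhop * rhom] times [um - up] and [um - up + (Pp - Pm)]; by [hu] these exceed [Pm] and
   [Pp] respectively. *)
have Q0 : 0 < Q.
  have h1 : 0 < um - up by have := hu; have := Pm0; lra.
  have h2 : 0 < um - up + (Pp - Pm) by have := hu; have := Pp0; lra.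
  by have := mulr_gt0 (mulr_gt0 (mulr_gt0 rhop0 rhom0) h1) h2; rewrite /Q; lra.
have wE : w_ = Num.sqrt (Q + 4^-1 * D ^+ 2) - 2^-1 * D.
  rewrite /w_ /w0 (over_powR_subr1 A alpha rhop0) (over_powR_subr1 A alpha rhom0).
  by [].
by rewrite wE; exact: positive_root.
Qed.

Lemma strength_vdelta : strength v_ = w_.
Proof. by rewrite /strength /v_ /vdelta -/w_; field; rewrite subr_eq0. Qed.

Lemma momentum_defect_vdelta : momentum_defect v_ = 0.
Proof.
have [_ wQ _] := w0_root.
have : (rhop - rhom) * momentum_defect v_ = 0.
  by rewrite strength_quadratic strength_vdelta wQ subrr.
by move/eqP; rewrite mulf_eq0 subr_eq0 (negbTE hrho) => /eqP.
Qed.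

(** Positivity selects the root [w_], and the strength determines [v] because [rhop != rhom]. *)
Lemma vdelta_unique v : 0 < strength v -> momentum_defect v = 0 ->
  v = v_ /\ strength v = w_.
Proof.
move=> s0 v0; have [_ _ wU] := w0_root.
have sw : strength v = w_.
  apply: wU => //; apply/eqP.
  by rewrite -subr_eq0 -strength_quadratic v0 mulr0.
split=> //; rewrite /v_ /vdelta -/w_ -sw /strength.
by field; rewrite subr_eq0.
Qed.

Lemma overcompressive_vdelta : up < v_ /\ v_ < um - Pm.
Proof.
have [w_gt0 _ _] := w0_root.
have [|||a0 b0] := @overcompressive_root R (v_ - up) (um - Pm - v_) _ _ _ _
  rhom0 rhop0 Pm0 Pp0.
- by have := hu; lra.
- have := momentum_defect_vdelta; rewrite /momentum_defect => e0.
  by apply/eqP; rewrite -subr_eq0 -e0; apply/eqP; ring.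
- have := strength_vdelta; rewrite /strength => sw.
  suff -> : rhop * (v_ - up) + rhom * (um - Pm - v_ + Pm) = w_ by [].
  by rewrite -sw; ring.
by lra.
Qed.

(** Replaces functions known only at nonnegative times by polynomials on the whole line, where the
    balance law asks for derivatives. *)
Lemma pairing_two_state (x X c C : R -> R) (f : R -> R -> R) (psi : R * R -> R) :
  (forall t, 0 <= t -> x t = X t) -> (forall t, 0 <= t -> c t = C t) ->
  pair_ x f c psi =
  \int[(lebesgue_measure \x lebesgue_measure)%E]_(z in setT `*` `]0, +oo[)
    (two_state X (fun t => f rhom (um + beta * t))
                 (fun t => f rhop (up + beta * t)) z * psi z) +
  \int[lebesgue_measure]_(t in `]0, +oo[) (C t * psi (X t, t)).
Proof.
move=> xX cC; rewrite /pairing; congr (_ + _); apply: eq_Rintegral.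
  move=> z; rewrite inE => -[_ /=]; rewrite in_itv/= andbT => z0.
  rewrite /two_state /rho_hat /u_hat xX ?ltW//.
  by case: ifP.
move=> t; rewrite inE/= in_itv/= andbT => t0.
by rewrite xX ?cC ?ltW.
Qed.

Lemma weak_solution_vdelta (x w udelta : R -> R) :
  (forall t, 0 <= t -> udelta t = v_ + beta * t) ->
  (forall t, 0 <= t -> x t = v_ * t + 2^-1 * beta * t ^+ 2) ->
  (forall t, 0 <= t -> w t = w_ * t) ->
  weak_solution A alpha beta rhom rhop um up x w udelta.
Proof.
move=> uE xE wE psi psi_test.
pose X t := v_ * t + 2^-1 * beta * t ^+ 2.
pose X' t := v_ + beta * t.
have dX (t : R) : is_derive t 1 X (X' t).
  have -> : X' t = v_ + 2 * (2^-1 * beta) * t by rewrite /X'; field.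
  by apply: (@is_derive_quadratic _ 0) => s; rewrite /X add0r.
have cX' : continuous X'.
  by apply: (@continuous_quadratic _ v_ beta 0) => s; rewrite /X'; ring.
have ccst (r : R) : continuous (fun _ : R => r) by move=> t; exact: cvg_cst.
have cw : continuous (fun t => w_ * t).
  by apply: (@continuous_quadratic _ 0 w_ 0) => s; ring.
have wuE t : 0 <= t -> w t * udelta t = w_ * t * X' t.
  by move=> t0; rewrite wE// uE.
have wuuE t : 0 <= t -> w t * udelta t ^+ 2 = w_ * t * X' t * X' t.
  by move=> t0; rewrite wE// uE// expr2 mulrA.
split.
  have e1 := pairing_two_state (@mass R) (partial_t psi) xE wE.
  have e2 := pairing_two_state (@mass_flux R) (partial_x psi) xE wuE.
  apply: (etrans (congr2 +%R e1 e2)).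
  (* Conservation of mass is the balance law with [k] and all sources equal to zero. *)
  have H := @front_balance_law R psi X X'
    (fun t => mass rhom (um + beta * t)) (fun t => mass rhop (up + beta * t))
    (fun t => w_ * t) (fun t => mass_flux rhom (um + beta * t))
    (fun t => mass_flux rhop (up + beta * t)) (cst 0) (cst 0) (cst 0) 0
    psi_test dX cX'.
  have bal0 (y z s : R) : y + z + 0 * s = 0 -> y + z = 0 by rewrite mul0r addr0.
  apply: (bal0 _ _ _ (H _ _ _ _ _ _ _ _)); rewrite {H}/mass /mass_flux.
  - by move=> t; rewrite mul0r; exact: is_derive_cst.
  - exact: ccst.
  - by move=> t; rewrite mul0r; exact: is_derive_cst.
  - exact: ccst.
  - move=> t; rewrite mul0r addr0.
    rewrite [X in is_derive _ _ _ X](_ : _ = w_); last first.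
      by rewrite -strength_vdelta -(jump_mass_balance _ t).
    rewrite [X in is_derive _ _ _ X](_ : _ = w_ + 2 * 0 * t); last by ring.
    by apply: (@is_derive_quadratic _ 0) => s; ring.
  - exact: ccst.
  - by apply: (@continuous_quadratic _ (rhom * um) (rhom * beta) 0) => s; ring.
  - by apply: (@continuous_quadratic _ (rhop * up) (rhop * beta) 0) => s; ring.
have e1 := pairing_two_state (momentum A alpha) (partial_t psi) xE wuE.
have e2 := pairing_two_state (momentum_flux A alpha) (partial_x psi) xE wuuE.
have e3 := pairing_two_state (@mass R) psi xE wE.
apply/eqP; rewrite -subr_eq0 opprK; apply/eqP.
apply: (etrans (congr2 +%R (congr2 +%R e1 e2) (congr1 ( *%R beta) e3))).
have dm (r u P t : R) : is_derive t 1 (fun t => r * (u + beta * t - P)) (beta * r).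
  rewrite [X in is_derive _ _ _ X](_ : _ = r * beta + 2 * 0 * t); last by ring.
  by apply: (@is_derive_quadratic _ (r * (u - P))) => s; ring.
have cf (r u P : R) : continuous (fun t => r * (u + beta * t) * (u + beta * t - P)).
  apply: (@continuous_quadratic _ (r * u * (u - P))
    (r * beta * (u + u - P)) (r * beta ^+ 2)) => s; ring.
(* For momentum [k] is [beta] and the source is the mass, with weight [w_ * t] on the front. *)
have H := @front_balance_law R psi X X'
  (fun t => momentum A alpha rhom (um + beta * t))
  (fun t => momentum A alpha rhop (up + beta * t)) (fun t => w_ * t * X' t)
  (fun t => momentum_flux A alpha rhom (um + beta * t))
  (fun t => momentum_flux A alpha rhop (up + beta * t))
  (fun t => mass rhom (um + beta * t)) (fun t => mass rhop (up + beta * t))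
  (fun t => w_ * t) beta psi_test dX cX'.
rewrite /momentum /momentum_flux /mass in H *.
apply: (H (dm _ _ _) (ccst _) (dm _ _ _) (ccst _)).
- move=> t; rewrite [X in is_derive _ _ _ X](_ : _ = w_ * v_ + 2 * (w_ * beta) * t).
    by apply: (@is_derive_quadratic _ 0) => s; rewrite /X'; ring.
  have := jump_momentum_balance v_ t.
  rewrite strength_vdelta momentum_defect_vdelta subr0 /jump /X' => ->.
  by rewrite /mass; ring.
- exact: cw.
- exact: cf.
- exact: cf.
Qed.

End delta_shock.

Theorem theorem4p2 (R : realType) (A alpha beta rhom rhop um up : R)
    (hA : 0 < A) (halpha0 : 0 < alpha) (halpha1 : alpha < 1)
    (hrhom : 0 < rhom) (hrhop : 0 < rhop)
    (hu : up < um - A / rhom `^ alpha) (hrho : rhop != rhom) :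
  forall x w udelta sigma : R -> R,
    delta_shock_solution A alpha beta rhom rhop um up x w udelta sigma <->
    (forall t, 0 <= t ->
       [/\ sigma t = udelta t,
           udelta t = vdelta A alpha rhom rhop um up + beta * t,
           x t = vdelta A alpha rhom rhop um up * t + 2^-1 * beta * t ^+ 2 &
           w t = w0 A alpha rhom rhop um up * t]).
Proof.
move=> x w udelta sigma.
have Pm0 : 0 < A / rhom `^ alpha by rewrite divr_gt0// powR_gt0.
split=> [[_ [x0 w0E] [v uv] RH [oc _]]|sol].
  have uE t : 0 <= t -> udelta t = v + beta * t.
    by move=> /uv <-; rewrite subrK.
  have sE t : 0 <= t -> sigma t = v + beta * t.
    by move=> t0; have [-> _ _ _] := RH _ t0; exact: uE.
  have xE t : 0 <= t -> x t = v * t + 2^-1 * beta * t ^+ 2.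
    apply: (@has_derivative_ge0_unique _ x (fun t => v * t + 2^-1 * beta * t ^+ 2)
      (fun t => v + beta * t)).
    - by rewrite x0; ring.
    - by move=> s s0; have [_ + _ _] := RH _ s0; rewrite sE.
    - move=> s; have -> : v + beta * s = v + 2 * (2^-1 * beta) * s by field.
      by apply: (@is_derive_quadratic _ 0) => r; ring.
  pose c := strength rhom rhop um up v.
  have wE t : 0 <= t -> w t = c * t.
    apply: (@has_derivative_ge0_unique _ w (fun t => c * t) (fun=> c)).
    - by rewrite w0E mulr0.
    - move=> s s0; have [_ _ + _] := RH _ s0.
      by rewrite sE// jump_mass_balance.
    - move=> s; rewrite [X in is_derive _ _ _ X](_ : _ = c + 2 * 0 * s); last by ring.
      by apply: (@is_derive_quadratic _ 0) => r; ring.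
  (* The entropy condition at time 0 places [v] between [up] and [um], and the strength is
     [rhop * (v - up) + rhom * (um - v)]. *)
  have c0 : 0 < c.
    have [] := oc 0 (lexx _); rewrite uE// !mulr0 !addr0 => upv vum.
    have h1 : 0 < rhop * (v - up) by rewrite mulr_gt0// subr_gt0.
    have h2 : 0 < rhom * (um - v) by rewrite mulr_gt0//; lra.
    by rewrite /c /strength; lra.
  (* The momentum condition is read at time 1: at a positive time the derivative is two-sided, hence
     unique, and can be compared with that of the explicit quadratic. *)
  have defect0 : momentum_defect A alpha rhom rhop um up v = 0.
    have [_ _ _] := RH 1 ler01.
    rewrite sE// jump_momentum_balance wE// -/c => d1.
    have d1' : has_derivative_ge0 (fun s => c * s * (v + beta * s)) 1
        (c * (v + beta * 1) - momentum_defect A alpha rhom rhop um up v +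
         beta * (c * 1)).
      by apply: eq_has_derivative_ge0 d1 => // s s0; rewrite wE// uE.
    have [_ e1] := has_derivative_ge0_is_derive ltr01 d1'.
    have [_ e2] : is_derive (1 : R) 1 (fun s => c * s * (v + beta * s))
        (c * v + 2 * (c * beta) * 1).
      by apply: (@is_derive_quadratic _ 0) => s; ring.
    have := etrans (esym e1) e2; lra.
  have [ve ce] := vdelta_unique hA hrhom hrhop hu hrho c0 defect0.
  by move=> t t0; rewrite -ve -ce; split; [rewrite sE ?uE|exact: uE|exact: xE|exact: wE].
have sE t : 0 <= t -> sigma t = udelta t by move=> /sol[].
have uE t : 0 <= t -> udelta t = vdelta A alpha rhom rhop um up + beta * t.
  by move=> /sol[].
have xE t : 0 <= t -> x t = vdelta A alpha rhom rhop um up * t + 2^-1 * beta * t ^+ 2.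
  by move=> /sol[].
have wE t : 0 <= t -> w t = w0 A alpha rhom rhop um up * t by move=> /sol[].
set v := vdelta _ _ _ _ _ _ in uE xE; set c := w0 _ _ _ _ _ _ in wE.
have sv : strength rhom rhop um up v = c by exact: strength_vdelta.
have dv : momentum_defect A alpha rhom rhop um up v = 0.
  exact: momentum_defect_vdelta.
split.
- split; last split.
  + by apply: (@smooth_ge0_quadratic _ 0 v (2^-1 * beta)) => t /xE ->; ring.
  + by apply: (@smooth_ge0_quadratic _ 0 c 0) => t /wE ->; ring.
  + by apply: (@smooth_ge0_quadratic _ v beta 0) => t /uE ->; ring.
- by rewrite xE// wE// !mulr0 expr2 !mulr0 addr0.
- by exists v => t /uE ->; ring.
- move=> t t0; split; first exact: sE.
  + apply: (@eq_has_derivative_ge0 _ (fun t => v * t + 2^-1 * beta * t ^+ 2)) => //.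
      by move=> s /xE ->.
    apply: is_derive_has_derivative_ge0; rewrite sE// uE//.
    have -> : v + beta * t = v + 2 * (2^-1 * beta) * t by field.
    by apply: (@is_derive_quadratic _ 0) => s; ring.
  + apply: (@eq_has_derivative_ge0 _ (fun t => c * t)) => //.
      by move=> s /wE ->.
    apply: is_derive_has_derivative_ge0; rewrite sE// uE// jump_mass_balance sv.
    rewrite [X in is_derive _ _ _ X](_ : _ = c + 2 * 0 * t); last by ring.
    by apply: (@is_derive_quadratic _ 0) => s; ring.
  + apply: (@eq_has_derivative_ge0 _ (fun t => c * t * (v + beta * t))) => //.
      by move=> s s0; rewrite wE// uE.
    apply: is_derive_has_derivative_ge0.
    rewrite sE// uE// jump_momentum_balance sv dv wE//.
    rewrite [X in is_derive _ _ _ X](_ : _ = c * v + 2 * (c * beta) * t); last by ring.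
    by apply: (@is_derive_quadratic _ 0) => s; ring.
- split.
    (* All terms shift by [beta * t], so the entropy condition at every time is the one at time
       0. *)
    have [upv vum] : up < v /\ v < um - A / rhom `^ alpha.
      exact: overcompressive_vdelta.
    by move=> t /uE ->; rewrite !ltrD2r.
  exact: weak_solution_vdelta.
Qed.
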